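(* Let $\Phi$ be the cumulative distribution function of the standard Gaussian distribution on $\mathbb{R}$. For every $T>0$, $$V_T^\infty\ge\sqrt{T}\,\Phi^{-1}\Big(\frac{1+e^{-T/\pi}}{2}\Big).$$
   Context: For $T>0$, on a probability space hosting a one-dimensional standard Brownian motion $B=(B(t))_{0\le t\le T}$, define $$V_T^\infty=\inf\Big\{\Big\|\int_0^T\alpha(t)\,dt+B(T)\Big\|_\infty:\ \|\alpha(t)\|_2\le\sqrt{2/\pi}\ \text{ for all }t\in[0,T]\Big\},$$ where the infimum is over real-valued processes $\alpha$ progressively measurable with respect to the filtration of $B$ satisfying the displayed constraint. Here $\|X\|_2=\mathbb{E}[X^2]^{1/2}$ and $\|X\|_\infty=\operatorname{ess\,sup}|X|$. *)

(* Defs.v *)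
From HB Require Import structures.
From mathcomp Require Import all_boot all_order all_algebra.
From mathcomp Require Import all_classical all_reals all_analysis.

Set Implicit Arguments.
Unset Strict Implicit.
Unset Printing Implicit Defensive.

Import Order.TTheory GRing.Theory Num.Theory.
Import numFieldNormedType.Exports.

Local Open Scope classical_set_scope.
Local Open Scope ring_scope.

Definition Phi {R : realType} (x : R) : R :=
  fine (normal_prob 0 1 `]-oo, x]).

(* [pinv] is the library's inverse of an arbitrary function; its values are
   meaningful on the range of [Phi], that is on ]0, 1[. *)
Definition Phi_inv {R : realType} : R -> R := pinv [set: R] Phi.

Section brownian_motion.
Context {R : realType} {d : measure_display} {Omega : measurableType d}.
Variable P : probability Omega R.

(* Processes are indexed by R; only the times in [0, T] matter. *)
Implicit Types (B : R -> {RV P >-> R}) (alpha : R -> Omega -> R) (T : R).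

(* The filtration of B, without augmentation by null sets:
   F_t is generated by the random variables B s with s in [0, t]. *)
Definition past_events B (t : R) : set_system Omega :=
  \bigcup_(s in `[0, t]) preimage_set_system [set: Omega] (B s) measurable.

Definition filtration B (t : R) : set_system Omega := <<s past_events B t >>.

Definition increment B (s t : R) : Omega -> R := fun w => B t w - B s w.

Definition standard_brownian_motion T B : Prop :=
  [/\ \forall w \ae P, B 0 w = 0,
      \forall w \ae P, {within `[0, T], continuous (fun t : R => B t w : R)},
      forall s t : R, 0 <= s -> s < t -> t <= T ->
        forall A : set R, measurable A ->
        P (increment B s t @^-1` A) =
          normal_prob 0 (Num.sqrt (t - s)) A
    & forall s t : R, 0 <= s -> s < t -> t <= T ->
        forall (A : set R) (C : set Omega), measurable A -> filtration B s C ->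
        P (increment B s t @^-1` A `&` C) =
          (P (increment B s t @^-1` A) * P C)%E].

(* The measurable structure on the product is the one of Borel(R) (x) F_t. *)
Definition progressively_measurable T B alpha : Prop :=
  forall t : R, 0 <= t <= T ->
    measurable_fun (`[0, t] `*` setT)
      (fun p : R * g_sigma_algebraType (past_events B t) => alpha p.1 p.2).

Definition admissible T B alpha : Prop :=
  progressively_measurable T B alpha /\
  forall t : R, 0 <= t <= T ->
    ('N[P]_2%:E [EFin \o alpha t] <= (Num.sqrt (2 / pi))%:E)%E.

(* By Fubini, the time integral of an admissible alpha is almost surely an
   integral of a Lebesgue-integrable function, so the value [Rintegral] takes
   elsewhere does not affect the norm. *)
Definition terminal_value T B alpha (w : Omega) : R :=
  (\int[lebesgue_measure]_(t in `[0, T]) alpha t w) + B T w.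

Definition V_infty T B : \bar R :=
  ereal_inf [set ('N[P]_+oo [EFin \o terminal_value T B alpha])%E |
             alpha in admissible T B].

End brownian_motion.

(* Main.v *)
(* Let [A] be the primitive of the drift and [h = T / (n + 1)].  Delaying the
   drift by one step of the grid, [Y_k = B (k h) + A ((k - 1) h)] is a Gaussian
   random walk whose k-th displacement [a_k] is known before the k-th Gaussian
   increment is drawn.  One step of such a walk satisfies the entropy inequality
   [E ln g (Y + a + N) <= E ln (heat g) (Y) + E a^2 / (2 h)], by the Gibbs
   variational principle and the Cameron-Martin shift of the Gaussian.  Chaining
   the steps gives [E ln g (Y_{n+1}) <= ln E g (B T) + T / pi], because
   [E a_k^2 <= h^2 * 2 / pi].  Since [Y_{n+1}] differs from the terminal value by
   a term that is O(h) in L^2, taking for [ln g] a large multiple of the indicator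
   of [|x| <= V + eps] and letting [n -> oo] bounds [P (|B T| <= V + eps)] below
   by [exp (- T / pi)]. *)

From HB Require Import structures.
Require Import Defs.
From mathcomp Require Import all_boot all_order all_algebra.
From mathcomp Require Import all_classical all_reals all_analysis.
From mathcomp Require Import measurable_realfun ess_sup_inf ring lra.

Import Order.TTheory GRing.Theory Num.Theory.
Import numFieldNormedType.Exports.

Local Open Scope classical_set_scope.
Local Open Scope ring_scope.

(** * The Gaussian semigroup *)

Section gaussian.
Context {R : realType}.
Local Notation mu := (@lebesgue_measure R).
Local Notation gauss s := (normal_prob (0 : R) s).

(** * Changes of variables for Gaussian integrals *)

(** The Radon-Nikodym derivative of [normal_prob m s] agrees almost everywhere with
    [normal_pdf m s], because both have the same integral over every measurable set. *)
Lemma ge0_integral_normal_prob (m s : R) (f : R -> \bar R) :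
  measurable_fun setT f -> (forall x, 0 <= f x)%E ->
  (\int[normal_prob m s]_x f x = \int[mu]_x (f x * (normal_pdf m s x)%:E))%E.
Proof.
move=> mf f0; have dom := normal_prob_dominates m s.
rewrite -(Radon_Nikodym_SigmaFinite.change_of_variables dom)//.
have intRN := Radon_Nikodym_SigmaFinite.f_integrable dom.
have mRN := measurable_int _ intRN.
have mpdf : measurable_fun setT (fun x => (normal_pdf m s x)%:E).
  by apply/measurable_EFinP; exact: measurable_normal_pdf.
apply: ae_eq_integral => //; [exact: emeasurable_funM..|].
apply: ae_eqe_mul2l; apply: integral_ae_eq => // A _ mA.
by rewrite -Radon_Nikodym_SigmaFinite.f_integral.
Qed.

(** The image of [mu] under [x |-> s * x + a], multiplied by [s], agrees with [mu] on half-open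
    intervals, hence everywhere by uniqueness of Lebesgue measure. *)
Lemma ge0_integral_lebesgue_affine (s a : R) (f : R -> \bar R) : 0 < s ->
  measurable_fun setT f -> (forall x, 0 <= f x)%E ->
  (\int[mu]_x f x = \int[mu]_x (f (s * x + a)%R * s%:E))%E.
Proof.
move=> s0 mf f0.
pose phi : measurableTypeR R -> measurableTypeR R := fun x => s * x + a.
have mphi : measurable_fun setT phi by apply: measurable_funD => //; exact: measurable_funM.
have sN0 : s != 0 by rewrite gt_eqF.
have itvE (b c : R) : phi @^-1` `]b, c] = `](b - a) / s, (c - a) / s]%classic.
  apply/seteqP; split=> x /=; rewrite !in_itv/= /phi ltr_pdivrMr// ler_pdivlMr//;
  by move=> /andP[? ?]; apply/andP; split; lra.
pose smu : {measure set (measurableTypeR R) -> \bar R} := mscale (NngNum (ltW s0)) mu.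
have smuE (A : set (measurableTypeR R)) : measurable A -> mu A = pushforward smu phi A.
  move=> mA; apply: lebesgue_measure_unique => //= _ [[b c]] _ <-.
  rewrite /pushforward itvE /smu/= /mscale/= !lebesgue_measure_itv/= !lte_fin.
  rewrite ltr_pM2r ?invr_gt0// ltrD2r; case: ifPn => bc; last by rewrite mule0.
  by rewrite -!EFinD -EFinM; congr EFin; field.
rewrite (eq_measure_integral (pushforward smu phi)); last by move=> A mA _; exact: smuE.
rewrite ge0_integral_pushforward// preimage_setT/= ge0_integral_mscale//=; last first.
  exact: measurableT_comp.
rewrite -ge0_integralZl//=; [|exact: measurableT_comp|by rewrite lee_fin ltW].
by apply: eq_integral => x _; rewrite muleC.
Qed.

Lemma normal_pdf_scale (s x : R) : 0 < s ->
  normal_pdf 0 s (s * x) * s = normal_pdf 0 1 x.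
Proof.
move=> s0; have sN0 : s != 0 by rewrite gt_eqF.
rewrite !normal_pdfE ?oner_eq0// /normal_peak /normal_fun !subr0.
have -> : s ^+ 2 * pi *+ 2 = s ^+ 2 * (1 ^+ 2 * pi *+ 2).
  by rewrite expr1n mul1r mulrnAr.
rewrite sqrtrM ?sqr_ge0// sqrtr_sqr gtr0_norm// invfM.
have -> : - (s * x) ^+ 2 / (s ^+ 2 *+ 2) = - x ^+ 2 / (1 ^+ 2 *+ 2).
  rewrite expr1n exprMn -mulrN -(mulr_natr (s ^+ 2)) invfM mulrACA divff ?mul1r//.
  by rewrite expf_neq0.
by rewrite mulrC mulrA mulrA divff// mul1r.
Qed.

Lemma ge0_integral_lebesgue_opp (f : R -> \bar R) :
  measurable_fun setT f -> (forall x, 0 <= f x)%E ->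
  (\int[mu]_x f x = \int[mu]_x f (- x)%R)%E.
Proof.
move=> mf f0; pose opp : measurableTypeR R -> measurableTypeR R := -%R.
have mopp : measurable_fun setT opp by exact: measurable_funN.
rewrite (eq_measure_integral (pushforward mu opp)); last first.
  by move=> A mA _; exact/esym/lebesgue_measureN.
by rewrite ge0_integral_pushforward// preimage_setT.
Qed.

Lemma ge0_integral_gauss_scale (s : R) (f : R -> \bar R) : 0 < s ->
  measurable_fun setT f -> (forall x, 0 <= f x)%E ->
  (\int[gauss s]_x f x = \int[gauss 1]_x f (s * x)%R)%E.
Proof.
move=> s0 mf f0; have sN0 : s != 0 by rewrite gt_eqF.
have mpdf t : measurable_fun setT (fun x => (normal_pdf (0 : R) t x)%:E).
  by apply/measurable_EFinP; exact: measurable_normal_pdf.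
rewrite (ge0_integral_normal_prob 0 s f mf f0) (ge0_integral_normal_prob 0 1); first last.
- by move=> x; exact: f0.
- exact: measurableT_comp.
rewrite (ge0_integral_lebesgue_affine s 0)//; last 2 first.
- exact: emeasurable_funM.
- by move=> x; rewrite mule_ge0// lee_fin normal_pdf_ge0.
apply: eq_integral => x _; rewrite addr0 -muleA -EFinM; congr (_ * _%:E)%E.
by rewrite normal_pdf_scale.
Qed.

Lemma ge0_integral_gauss_opp (s : R) (f : R -> \bar R) : 0 < s ->
  measurable_fun setT f -> (forall x, 0 <= f x)%E ->
  (\int[gauss s]_x f x = \int[gauss s]_x f (- x)%R)%E.
Proof.
move=> s0 mf f0; have sN0 : s != 0 by rewrite gt_eqF.
have mpdf : measurable_fun setT (fun x => (normal_pdf (0 : R) s x)%:E).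
  by apply/measurable_EFinP; exact: measurable_normal_pdf.
rewrite (ge0_integral_normal_prob 0 s f mf f0).
rewrite (ge0_integral_normal_prob 0 s (fun x => f (- x)%R)); first last.
- by move=> x; exact: f0.
- exact: measurableT_comp.
rewrite ge0_integral_lebesgue_opp; first last.
- by move=> x; rewrite mule_ge0// lee_fin normal_pdf_ge0.
- exact: emeasurable_funM.
apply: eq_integral => x _.
by rewrite !normal_pdfE// /normal_fun !subr0 sqrrN.
Qed.

(** Cameron-Martin formula: by completing the square, the exponential factor times the density at
    [x] is the density at [x + a], and Lebesgue measure is translation invariant. *)
Lemma ge0_integral_gauss_shift (s a : R) (f : R -> \bar R) : 0 < s ->
  measurable_fun setT f -> (forall x, 0 <= f x)%E ->
  (\int[gauss s]_x (f (x + a)%R * (expR (- ((a * x + a ^+ 2 / 2) / s ^+ 2)))%:E)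
   = \int[gauss s]_x f x)%E.
Proof.
move=> s0 mf f0; have sN0 : s != 0 by rewrite gt_eqF.
have mpdf : measurable_fun setT (fun x => (normal_pdf (0 : R) s x)%:E).
  by apply/measurable_EFinP; exact: measurable_normal_pdf.
rewrite (ge0_integral_normal_prob 0 s f mf f0) (ge0_integral_normal_prob 0 s); last 2 first.
- apply: emeasurable_funM.
    by apply: measurableT_comp => //; exact: measurable_funD.
  apply/measurable_EFinP/measurableT_comp => //; apply: measurable_funN.
  by apply: measurable_funM => //; apply: measurable_funD => //; exact: measurable_funM.
- by move=> x; rewrite mule_ge0// lee_fin expR_ge0.
rewrite [RHS](ge0_integral_lebesgue_affine 1 a)//; last 2 first.
- exact: emeasurable_funM.
- by move=> x; rewrite mule_ge0// lee_fin normal_pdf_ge0.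
apply: eq_integral => x _; rewrite mule1 mul1r -muleA; congr (_ * _)%E.
rewrite -EFinM normal_pdfE// mulrCA /normal_fun -expRD; congr (_ * expR _)%:E.
by rewrite -(mulr_natr (s ^+ 2)); field.
Qed.

Lemma integrable_gauss_id (s : R) : 0 < s -> (gauss s).-integrable setT EFin.
Proof.
move=> s0; have sN0 : s != 0 by rewrite gt_eqF.
apply/integrableP; split; first exact: EFin_measurable.
have mexp : measurable_fun setT (fun x : R => (expR x)%:E).
  by apply/measurable_EFinP; exact: measurable_expR.
have mexpN : measurable_fun setT (fun x : R => (expR (- x))%:E).
  by apply/measurable_EFinP; apply: measurableT_comp => //; exact: measurable_expR.
have exp0 (x : R) : (0 <= (expR x)%:E)%E by rewrite lee_fin expR_ge0.
have expfin : (\int[gauss s]_x (expR x)%:E < +oo)%E.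
  (* Shifting the constant [1] by [- s ^+ 2] turns the exponential factor into
     [expR (x - s ^+ 2 / 2)], so [expR] has a finite integral; it then dominates through
     [|x| <= expR x + expR (- x)]. *)
  have := ge0_integral_gauss_shift s (- s ^+ 2) (cst 1%E) s0 (measurable_cst _) (fun=> lee01).
  have -> : (\int[gauss s]_x (cst 1%E : R -> \bar R) x = 1)%E.
    by rewrite integral_cst// mul1e; exact: (probability_setT (gauss s)).
  rewrite /cst.
  under eq_integral => x _.
    rewrite mul1e (_ : - _ = x + - (s ^+ 2 / 2)); last by field.
    rewrite expRD EFinM muleC.
    over.
  rewrite ge0_integralZl//.
  case: (\int[gauss s]_x (expR x)%:E)%E => [r| |]//; first by rewrite ltry.
  by rewrite mulry gtr0_sg ?expR_gt0// mul1e.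
apply: (@le_lt_trans _ _ (\int[gauss s]_x ((expR x)%:E + (expR (- x))%:E))%E).
  apply: ge0_le_integral => //.
  - by apply: measurableT_comp => //; exact: EFin_measurable.
  - exact: emeasurable_funD.
  - move=> x _; rewrite lee_fin ler_norml.
    have := expR_ge1Dx x; have := expR_ge1Dx (- x).
    have := expR_gt0 x; have := expR_gt0 (- x).
    by move=> ? ? ? ?; apply/andP; split; lra.
rewrite ge0_integralD//.
by rewrite -(ge0_integral_gauss_opp s _ s0 mexp exp0) lte_add_pinfty.
Qed.

Lemma gauss_mean (s : R) : 0 < s -> \int[gauss s]_x x = 0.
Proof.
move=> s0; have intid := integrable_gauss_id s s0.
have /integrableP[_ neg_lty] := integrable_funeneg measurableT intid.
rewrite /Rintegral integralE.
have -> : (\int[gauss s]_x (EFin^\+ x) = \int[gauss s]_x (EFin^\- x))%E.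
  rewrite (ge0_integral_gauss_opp s)//; last first.
    by apply: measurable_funepos; exact: EFin_measurable.
  by apply: eq_integral => x _; rewrite funeposE funenegE EFinN.
rewrite subee// ge0_fin_numE ?integral_ge0//.
by move: neg_lty; under eq_integral do rewrite gee0_abs//.
Qed.

(** * The heat semigroup and the one-step entropy inequality *)

(** The parameter is a standard deviation: [heat s] is the Brownian transition over a time
    [s ^+ 2]. *)
Definition heat (s : R) (g : R -> R) (x : R) : R := \int[gauss s]_z g (x + z).

(** The lower bound [1] makes [ln (g x)] nonnegative, so its integrals can be handled in [\bar R];
    the upper bound gives integrability. Averaging by [heat] preserves both. *)
Definition weight (M : R) (g : R -> R) : Prop :=
  measurable_fun setT g /\ forall x, 1 <= g x <= M.

Lemma bounded_integrable d (T : measurableType d) (Q : probability T R)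
    (M : R) (f : T -> R) :
  measurable_fun setT f -> (forall x, `|f x| <= M) ->
  Q.-integrable setT (EFin \o f).
Proof.
move=> mf fM; apply: (@le_integrable _ _ _ _ _ _ _ (cst M%:E)) => //.
- exact/measurable_EFinP.
- move=> x _; rewrite lee_fin; apply: le_trans (fM x) _; exact: ler_norm.
- exact: finite_measure_integrable_cst.
Qed.

Lemma weight_integrable (s M y : R) (g : R -> R) : weight M g ->
  (gauss s).-integrable setT (EFin \o (fun z => g (y + z))).
Proof.
move=> [mg gM]; apply: (bounded_integrable _ _ _ M).
  by apply: measurableT_comp => //; exact: measurable_funD.
move=> z; have /andP[g1 g2] := gM (y + z).
by rewrite ger0_norm// (le_trans _ g1).
Qed.

Lemma heatE (s M y : R) (g : R -> R) : weight M g ->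
  (heat s g y)%:E = (\int[gauss s]_z (g (y + z))%:E)%E.
Proof.
move=> gM; rewrite /heat /Rintegral fineK//.
by apply: integrable_fin_num => //; exact: weight_integrable gM.
Qed.

Lemma heat_weight (s M : R) (g : R -> R) : weight M g -> weight M (heat s g).
Proof.
move=> gM; have [mg g1M] := gM; split; last first.
  have prob1 : gauss s setT = 1%E by exact: (probability_setT (gauss s)).
  move=> x; rewrite -!lee_fin (heatE _ _ _ _ gM).
  have mgx : measurable_fun setT (fun z => (g (x + z))%:E).
    apply/measurable_EFinP.
    by apply: measurableT_comp => //; exact: measurable_funD.
  have g1 z : 1 <= g z by have /andP[] := g1M z.
  have g0 z : 0 <= g z by rewrite (le_trans _ (g1 z)).
  have gle z : g z <= M by have /andP[] := g1M z.
  have cstE (r : R) : (\int[gauss s]_(_ in setT) r%:E = r%:E)%E.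
    by rewrite integral_cst// -[RHS]mule1; congr (_ * _)%E; exact: prob1.
  apply/andP; split.
  - rewrite -[leLHS](cstE 1).
    by apply: ge0_le_integral => // z _; rewrite lee_fin.
  - rewrite -[leRHS](cstE M).
    by apply: ge0_le_integral => // z _; rewrite lee_fin.
have -> : heat s g = fine \o fubini_F (gauss s) (fun p : R * R => (g (p.1 + p.2))%:E).
  by [].
apply: measurableT_comp => //; apply: measurable_fun_fubini_tonelli_F => //.
  apply/measurable_EFinP; apply: measurableT_comp => //.
  exact: measurable_funD.
by move=> p; rewrite lee_fin; have /andP[g1 _] := g1M (p.1 + p.2); rewrite (le_trans _ g1).
Qed.

(* The Gibbs variational inequality: [w] is minus the log-density of the tilted
   measure. *)
Lemma integral_ln_le d (T : measurableType d) (Q : probability T R)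
    (u w : T -> R) (C : R) : (forall x, 0 < u x) -> 0 < C ->
  Q.-integrable setT (EFin \o (fun x => ln (u x))) ->
  Q.-integrable setT (EFin \o w) ->
  Q.-integrable setT (EFin \o (fun x => u x * expR (- w x))) ->
  \int[Q]_x (u x * expR (- w x)) = C ->
  \int[Q]_x ln (u x) <= ln C + \int[Q]_x w x.
Proof.
move=> u0 C0 iln iw iuw intC.
have icst (r : R) : Q.-integrable setT (EFin \o (fun=> r)).
  exact: finite_measure_integrable_cst.
have iscaled : Q.-integrable setT
    (EFin \o (fun x => C^-1 * (u x * expR (- w x)))).
  by apply: eq_integrable (integrableZl measurableT C^-1 iuw).
have isum : Q.-integrable setT
    (EFin \o (fun x => w x + C^-1 * (u x * expR (- w x)))).
  by apply: eq_integrable (integrableD measurableT iw iscaled).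
(* With [y] the normalised tilted function, this is [ln y <= y - 1]; since [y] has mean [1], the
   constants cancel after integration. *)
have key x : ln (u x) <= (ln C - 1) + (w x + C^-1 * (u x * expR (- w x))).
  set y := C^-1 * _; have y0 : 0 < y.
    by rewrite mulr_gt0 ?invr_gt0// mulr_gt0 ?expR_gt0.
  have -> : ln (u x) = ln C + w x + ln y.
    rewrite !lnM ?posrE ?invr_gt0 ?mulr_gt0 ?expR_gt0// lnV ?posrE// expRK.
    by ring.
  suff : ln y <= y - 1 by lra.
  by rewrite -[y in leRHS](lnK y0) lerBrDl; exact: expR_ge1Dx.
apply: le_trans (le_Rintegral _ _ _ (fun x _ => key x)) _ => //.
  by apply: eq_integrable (integrableD measurableT (icst (ln C - 1)) isum).
rewrite (RintegralD measurableT (icst (ln C - 1)) isum).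
rewrite (RintegralD measurableT iw iscaled) RintegralZl// intC mulVf ?gt_eqF// Rintegral_cst//.
have -> : fine (Q setT) = 1 by rewrite probability_setT.
lra.
Qed.

(** The price [a ^+ 2 / (2 * s ^+ 2)] is the relative entropy between [gauss s] and its translate by
    [a]. *)
Lemma gauss_drift_le (s a y M : R) (g : R -> R) : 0 < s -> weight M g ->
  (\int[gauss s]_z (ln (g (y + a + z)))%:E
    <= (ln (heat s g y) + a ^+ 2 / (2 * s ^+ 2))%:E)%E.
Proof.
move=> s0 gM; have [mg g1M] := gM.
have [_ hM] := heat_weight s _ _ gM.
have g1 z : 1 <= g z by have /andP[] := g1M z.
have gpos z : 0 < g z by rewrite (lt_le_trans _ (g1 z)).
have h0 : 0 < heat s g y by have /andP[h1 _] := hM y; rewrite (lt_le_trans _ h1).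
pose c := a ^+ 2 / (2 * s ^+ 2).
(* [expR (- w z)] is the Cameron-Martin factor that removes the shift [a], and [w] has mean [c]
   because the Gaussian is centred. *)
pose w z := a / s ^+ 2 * z + c.
have mgy : measurable_fun setT (fun z => g (y + a + z)).
  by apply: measurableT_comp => //; exact: measurable_funD.
have mw : measurable_fun setT w.
  by apply: measurable_funD => //; exact: measurable_funM.
have iln : (gauss s).-integrable setT (EFin \o (fun z => ln (g (y + a + z)))).
  apply: (bounded_integrable _ _ _ (ln M)).
    by apply: measurableT_comp => //; exact: measurable_ln.
  move=> z; have /andP[_ gle] := g1M (y + a + z).
  by rewrite ger0_norm ?ln_ge0// ler_ln ?posrE// (lt_le_trans _ gle).
have ic : (gauss s).-integrable setT (EFin \o (fun=> c)).
  exact: finite_measure_integrable_cst.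
have iz : (gauss s).-integrable setT (EFin \o (fun z => a / s ^+ 2 * z)).
  by apply: eq_integrable
    (integrableZl measurableT (a / s ^+ 2) (integrable_gauss_id s s0)).
have iw : (gauss s).-integrable setT (EFin \o w).
  by apply: eq_integrable (integrableD measurableT iz ic).
have intw : \int[gauss s]_z w z = c.
  rewrite (RintegralD measurableT iz ic) RintegralZl//; last first.
    exact: integrable_gauss_id.
  rewrite gauss_mean// mulr0 add0r Rintegral_cst//.
  transitivity (c * 1); last exact: mulr1.
  by congr (_ * _); exact: (congr1 fine (probability_setT (gauss s))).
have shiftE : (\int[gauss s]_z (g (y + a + z) * expR (- w z))%:E
             = (heat s g y)%:E)%E.
  rewrite (heatE _ _ _ _ gM) -[RHS](ge0_integral_gauss_shift s a)//.
  - apply: eq_integral => z _; rewrite -EFinM /w/= (addrC z a) addrA.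
    by congr (_ * expR _)%:E; rewrite /c; field; rewrite gt_eqF.
  - apply/measurable_EFinP.
    by apply: measurableT_comp => //; exact: measurable_funD.
  - by move=> z; rewrite lee_fin ltW.
rewrite -/c -intw -[leLHS]fineK; last exact: integrable_fin_num.
rewrite lee_fin; apply: (integral_ln_le _ _ _ _ _ _ _ h0) => //.
- apply/integrableP; split.
    apply/measurable_EFinP; apply: measurable_funM => //.
    by apply: measurableT_comp => //; exact: measurable_funN.
  under eq_integral do rewrite gee0_abs ?lee_fin ?mulr_ge0 ?expR_ge0 ?(ltW (gpos _))//.
  by rewrite shiftE ltry.
- by rewrite /Rintegral shiftE.
Qed.

End gaussian.

(** * The distribution function *)

Section distribution_function.
Context {R : realType}.
Local Notation mu := (@lebesgue_measure R).
Local Notation gauss s := (normal_prob (0 : R) s).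
Local Notation N := (normal_prob (0 : R) 1).

Lemma PhiE (y : R) : N `]-oo, y] = (Phi y)%:E.
Proof. by rewrite /Phi fineK// fin_num_measure. Qed.

Lemma integral_gauss_indic (s : R) (A : set R) : measurable A ->
  (\int[gauss s]_x (\1_A x)%:E = gauss s A)%E.
Proof. by move=> mA; rewrite integral_indic// setIT. Qed.

Lemma gauss_scale (s : R) (A : set R) : 0 < s -> measurable A ->
  gauss s A = N ((fun x => s * x) @^-1` A).
Proof.
move=> s0 mA; have ms : measurable_fun setT (fun x : R => s * x) by exact: measurable_funM.
have mpre : measurable ((fun x => s * x) @^-1` A).
  by rewrite -[X in measurable X]setTI; exact: ms.
rewrite -(integral_gauss_indic s A mA) -(integral_gauss_indic 1 _ mpre).
have mind : measurable_fun setT (fun x : R => (\1_A x : R)%:E).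
  by apply/measurable_EFinP; exact: measurable_indic.
have ind0 x : (0 <= (\1_A x : R)%:E)%E by rewrite lee_fin.
by rewrite (ge0_integral_gauss_scale s _ s0 mind ind0).
Qed.

Lemma gauss_opp (s : R) (A : set R) : 0 < s -> measurable A ->
  gauss s A = gauss s (-%R @^-1` A).
Proof.
move=> s0 mA; have ms : measurable_fun setT (-%R : R -> R) by exact: measurable_funN.
have mpre : measurable (-%R @^-1` A) by rewrite -[X in measurable X]setTI; exact: ms.
rewrite -(integral_gauss_indic s A mA) -(integral_gauss_indic s _ mpre).
have mind : measurable_fun setT (fun x : R => (\1_A x : R)%:E).
  by apply/measurable_EFinP; exact: measurable_indic.
have ind0 x : (0 <= (\1_A x : R)%:E)%E by rewrite lee_fin.
by rewrite (ge0_integral_gauss_opp s _ s0 mind ind0).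
Qed.

Lemma PhiD (x y : R) : x <= y -> (Phi y)%:E = ((Phi x)%:E + N `]x, y])%E.
Proof.
move=> xy; rewrite -!PhiE -measureU//.
  by rewrite -itv_bndbnd_setU ?bnd_simp.
apply/seteqP; split => // z /= [].
by rewrite !in_itv/= => zx /andP[xz _]; move: (lt_le_trans xz zx); rewrite ltxx.
Qed.

Lemma Phi_lt (x y : R) : x < y -> Phi x < Phi y.
Proof.
move=> xy; rewrite -lte_fin (PhiD _ _ (ltW xy)) lteDl//.
(* On []x, y]] one has [z ^+ 2 <= x ^+ 2 + y ^+ 2], so [c] is a positive lower bound of the density
   there. *)
pose c := normal_peak (1 : R) * expR (- (x ^+ 2 + y ^+ 2) / 2).
have c0 : 0 < c by rewrite mulr_gt0 ?expR_gt0// normal_peak_gt0 ?oner_eq0.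
apply: (@lt_le_trans _ _ (\int[mu]_(z in `]x, y]) c%:E)%E).
  rewrite integral_cst//= lebesgue_measure_itv/= lte_fin xy -EFinD -EFinM lte_fin.
  by rewrite mulr_gt0// subr_gt0.
rewrite /normal_prob; apply: ge0_le_integral => //.
- by move=> z _; rewrite lee_fin ltW.
- by apply: measurable_funTS; apply/measurable_EFinP; exact: measurable_normal_pdf.
- move=> z /=; rewrite in_itv/= => /andP[xz zy].
  rewrite lee_fin normal_pdfE ?oner_eq0// /c ler_pM2l ?normal_peak_gt0 ?oner_eq0//.
  rewrite /normal_fun ler_expR subr0 expr1n -[1 *+ 2]/(2 : R).
  suff : z ^+ 2 <= x ^+ 2 + y ^+ 2 by lra.
  by have [z0|z0] := leP 0 z; nra.
Qed.

(** The density never exceeds its peak. This yields the continuity of [Phi] that the intermediate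
    value theorem requires. *)
Lemma Phi_lipschitz (x y : R) : x <= y ->
  Phi y - Phi x <= normal_peak 1 * (y - x).
Proof.
move=> xy; rewrite lerBlDl -lee_fin (PhiD _ _ xy) EFinD leeD2lE//.
apply: (@le_trans _ _ (\int[mu]_(z in `]x, y]) (normal_peak 1)%:E)%E).
  rewrite /normal_prob; apply: ge0_le_integral => //.
  - by move=> z _; rewrite lee_fin normal_pdf_ge0.
  - by apply: measurable_funTS; apply/measurable_EFinP; exact: measurable_normal_pdf.
  - by move=> z _; rewrite lee_fin normal_pdf_ub ?oner_eq0.
rewrite integral_cst//= lebesgue_measure_itv/= lte_fin.
case: ifPn => [_|]; first by rewrite -EFinD -EFinM lee_fin.
by rewrite mule0 lee_fin mulr_ge0 ?normal_peak_ge0// subr_ge0.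
Qed.

Lemma gauss_symmetric_itv (y : R) : 0 <= y ->
  N `[- y, y] = (2 * Phi y - 1)%:E.
Proof.
move=> y0; have Ny : N `]y, +oo[ = (1 - Phi y)%:E.
  have -> : `]y, +oo[%classic = ~` `]-oo, y]%classic :> set R by rewrite setCitvl.
  transitivity (1 - N `]-oo, y])%E; last by rewrite PhiE.
  exact: probability_setC.
have NNy : N `]-oo, (- y)[ = (1 - Phi y)%:E.
  rewrite -Ny [RHS]gauss_opp//; congr (normal_prob _ _ _).
  by apply/seteqP; split => z /=; rewrite !in_itv/= andbT; lra.
have : N `]-oo, y] = (N `]-oo, (- y)%R[ + N `[(- y)%R, y])%E.
  rewrite -measureU//.
    by rewrite -itv_bndbnd_setU ?bnd_simp//; lra.
  apply/seteqP; split => // z /= [].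
  by rewrite !in_itv/= => zx /andP[xz _]; move: (lt_le_trans zx xz); rewrite ltxx.
have fin : N `[- y, y] \is a fin_num by rewrite fin_num_measure.
rewrite PhiE NNy -(fineK fin) -EFinD => -[e].
by congr EFin; lra.
Qed.

(** Guarantees [Phi (Phi_inv v) = v], which [pinv] satisfies on the range. The values [1 / 2] at [0]
    and at least [v] far to the right enclose [v]. *)
Lemma Phi_surj (v : R) : 1 / 2 < v < 1 -> range Phi v.
Proof.
move=> /andP[v2 v1].
(* The degenerate interval [[0, 0]] has no mass, so the symmetric formula gives
   [2 * Phi 0 - 1 = 0]. *)
have Phi0 : Phi 0 = 1 / 2 :> R.
  have := gauss_symmetric_itv 0 (lexx _); rewrite oppr0 set_itv1.
  have -> : N [set 0] = 0%E.
    by rewrite /normal_prob integral_set1.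
  by move=> -[e]; lra.
have [b b0 vb] : exists2 b, 0 <= b & v <= Phi b.
  (* The identity is packaged as a random variable under [N]; its distribution function is [Phi],
     which therefore tends to [1] at infinity. *)
  have mid : measurable_fun setT (idfun : measurableTypeR R -> R).
    by move=> _ A mA; rewrite setTI.
  pose X : {mfun measurableTypeR R >-> R} := HB.pack
    (idfun : measurableTypeR R -> R) (isMeasurableFun.Build _ _ _ _ _ mid).
  have /fine_cvg := cvg_cdfy1 (X : {RV N >-> R}).
  move=> /cvgr_gt/(_ v v1) vN.
  have [b [vb b0]] := filter_ex (filterI vN (nbhs_pinfty_ge (num_real 0))).
  by exists b => //; exact: ltW vb.
have cPhi : {within `[0, b], continuous (Phi : R -> R)}.
  apply: continuous_subspaceT => x; apply/cvgrPdist_lt => e e0.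
  have K0 : 0 < normal_peak 1 :> R by rewrite normal_peak_gt0 ?oner_eq0.
  have lip (y z : R) : `|Phi y - Phi z| <= normal_peak 1 * `|y - z|.
    wlog yz : y z / z <= y => [h|].
      have [/h//|/ltW/h] := leP z y; by rewrite distrC (distrC z).
    rewrite (ger0_norm (_ : 0 <= y - z)) ?subr_ge0// ger0_norm ?Phi_lipschitz//.
    move: yz; rewrite subr_ge0 le_eqVlt => /predU1P[->//|/Phi_lt/ltW//].
  near=> z; apply: le_lt_trans (lip x z) _; rewrite -ltr_pdivlMl//.
  near: z; exists ((normal_peak 1)^-1 * e).
    by apply: mulr_gt0 => //; rewrite invr_gt0.
  by [].
have [|c _ cv] := @IVT R Phi 0 b v b0 cPhi; last by exists c.
by rewrite ge_min le_max Phi0 (ltW v2) vb orbT.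
Unshelve. all: by end_near.
Qed.

End distribution_function.

(** * Integrals depending on a parameter *)

Section fiber_integrals.
Context {R : realType}.
Local Notation mu := (@lebesgue_measure R).

Lemma restrict_fiber (U : Type) (D : set R) (f : R * U -> \bar R) (u : U) :
  ((fun x => f (x, u)) \_ D)%E = (fun x => (f \_ (D `*` setT)) (x, u)).
Proof.
apply/funext => x; rewrite !patchE; congr (if _ then _ else _).
by apply/idP/idP; rewrite !inE => //= -[].
Qed.

(** Measurability is only given over [D]; extending [f] by zero makes it global, so that Tonelli
    applies. *)
Lemma measurable_fun_ge0_fiber_integral d (U : measurableType d) (D : set R)
    (f : R * U -> \bar R) :
  measurable D -> measurable_fun (D `*` setT) f -> (forall p, 0 <= f p)%E ->
  measurable_fun setT (fun u => \int[mu]_(x in D) f (x, u))%E.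
Proof.
move=> mD mf f0; pose g := (f \_ (D `*` setT))%E.
have mg : measurable_fun setT g.
  by apply/(measurable_restrictT _ _).1 => //; exact: measurableX.
have g0 p : (0 <= g p)%E by rewrite /g patchE; case: ifP.
rewrite (_ : (fun u => _) = fubini_G mu g).
  exact: (measurable_fun_fubini_tonelli_G (m1 := mu) g mg g0).
by apply/funext => u; rewrite integral_mkcond restrict_fiber.
Qed.

Lemma measurable_fun_fiber_integral d (U : measurableType d) (D : set R)
    (f : R * U -> \bar R) :
  measurable D -> measurable_fun (D `*` setT) f ->
  measurable_fun setT (fun u => \int[mu]_(x in D) f (x, u))%E.
Proof.
move=> mD mf.
rewrite (_ : (fun u => _) = (fun u => \int[mu]_(x in D) f^\+ (x, u))
    \- (fun u => \int[mu]_(x in D) f^\- (x, u)))%E; last first.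
  apply/funext => u; rewrite integralE.
  by congr (_ - _)%E; apply: eq_integral => x _; rewrite ?funeposE ?funenegE.
apply: emeasurable_funB.
  apply: (measurable_fun_ge0_fiber_integral _ _ _ (f^\+)%E) => //.
  exact: measurable_funepos.
apply: (measurable_fun_ge0_fiber_integral _ _ _ (f^\-)%E) => //.
exact: measurable_funeneg.
Qed.

Lemma ge0_fiber_integral_swap d (U : measurableType d) (Q : probability U R)
    (D : set R) (f : R * U -> \bar R) :
  measurable D -> measurable_fun (D `*` setT) f -> (forall p, 0 <= f p)%E ->
  (\int[Q]_u \int[mu]_(x in D) f (x, u) = \int[mu]_(x in D) \int[Q]_u f (x, u))%E.
Proof.
move=> mD mf f0; pose g := (f \_ (D `*` setT))%E.
have mg : measurable_fun setT g.
  by apply/(measurable_restrictT _ _).1 => //; exact: measurableX.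
have g0 p : (0 <= g p)%E by rewrite /g patchE; case: ifP.
transitivity (\int[Q]_u \int[mu]_x g (x, u))%E.
  by apply: eq_integral => u _; rewrite integral_mkcond restrict_fiber.
rewrite -(fubini_tonelli (m1 := mu) g mg g0) [RHS]integral_mkcond.
apply: eq_integral => x _; rewrite patchE; case: ifPn => xD.
  by apply: eq_integral => u _; rewrite /g patchE ifT// inE; split => //; exact: set_mem.
rewrite integral0_eq// => u _; rewrite /g patchE ifF//; apply/negbTE.
by apply: contra xD; rewrite !inE => -[].
Qed.

(** Cauchy-Schwarz against the constant [1]. Along a path of the control, it bounds a squared
    displacement by the energy spent. *)
Lemma sqr_Rintegral_le d (U : measurableType d) (nu : {measure set U -> \bar R})
    (D : set U) (L : R) (f : U -> R) : measurable D -> 0 < L -> nu D = L%:E ->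
  nu.-integrable D (EFin \o f) -> nu.-integrable D (EFin \o (fun x => f x ^+ 2)) ->
  (\int[nu]_(x in D) f x) ^+ 2 <= L * \int[nu]_(x in D) f x ^+ 2.
Proof.
move=> mD L0 nuD if1 if2; set A := \int[nu]_(x in D) f x; pose r := A / L.
have icst : nu.-integrable D (EFin \o (fun=> - r ^+ 2)).
  apply/integrableP; split; first exact: measurable_cst.
  rewrite (eq_integral (cst (`|- r ^+ 2|)%:E))// integral_cst//.
  by rewrite nuD -EFinM ltry.
have iscaled : nu.-integrable D (EFin \o (fun x => 2 * r * f x)).
  by apply: eq_integrable (integrableZl mD (2 * r) if1).
have isum : nu.-integrable D (EFin \o (fun x => 2 * r * f x + - r ^+ 2)).
  by apply: eq_integrable (integrableD mD iscaled icst).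
(* Integrate [2 r f - r^2 <= f^2], where [r] is the mean of [f]. *)
have := le_Rintegral mD isum if2.
rewrite (RintegralD mD iscaled icst) (RintegralZl _ mD if1) Rintegral_cst// nuD/=.
move=> /(_ _)/wrap[]; first by move=> x _; have := sqr_ge0 (f x - r); nra.
rewrite -/A => h; rewrite -ler_pdivrMl//; apply: le_trans h.
by rewrite /r le_eqVlt; apply/orP; left; apply/eqP; field; rewrite gt_eqF.
Qed.

End fiber_integrals.

(** * Controlled Brownian motion *)

Section controlled_brownian_motion.
Context {R : realType} {d : measure_display} {Omega : measurableType d}.
Variable P : probability Omega R.
Local Notation mu := (@lebesgue_measure R).
Local Notation gauss s := (normal_prob (0 : R) s).
Implicit Types (B : R -> {RV P >-> R}) (T : R) (alpha : R -> Omega -> R).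

(** * Adaptedness and independence of the increments *)

(** The sigma-algebra belongs to the type of the domain, whose points are those of [Omega]; the same
    function can thus be read over any past. *)
Definition adapted B (t : R) (f : Omega -> R) : Prop :=
  measurable_fun [set: g_sigma_algebraType (past_events B t)] f.

Lemma filtration_measurable B t (C : set Omega) :
  filtration B t C -> measurable C.
Proof.
apply: smallest_sub; first exact: sigma_algebra_measurable.
move=> _ [s _] [A mA <-]; exact: measurable_funP.
Qed.

Lemma filtration_measurable_fun d' (U : measurableType d') B t (f : Omega -> U) :
  measurable_fun [set: g_sigma_algebraType (past_events B t)] f ->
  measurable_fun [set: Omega] f.
Proof.
move=> mf _ A mA; apply: (filtration_measurable B t).
exact: mf.
Qed.

Lemma adapted_measurable B t (f : Omega -> R) :
  adapted B t f -> measurable_fun setT f.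
Proof. exact: filtration_measurable_fun. Qed.

Lemma filtrationS B (s t : R) : s <= t ->
  filtration B s `<=` filtration B t.
Proof.
move=> st; apply: sub_sigma_algebra2 => A [r]; rewrite /= in_itv/= => /andP[r0 rs] Ar.
by exists r => //=; rewrite in_itv/= r0 (le_trans rs).
Qed.

Lemma adaptedS B (s t : R) (f : Omega -> R) : s <= t ->
  adapted B s f -> adapted B t f.
Proof. move=> st mf mT A mA; apply: (filtrationS B s t st); exact: mf. Qed.

Lemma adapted_path B (s t : R) : 0 <= s <= t -> adapted B t (B s).
Proof.
move=> st _ A mA; apply: sub_sigma_algebra; exists s; first by rewrite /= in_itv/=.
by exists A.
Qed.

(* The increment is independent of the past, so its joint law with the identity
   of [Omega], viewed as a map onto the past, is a product measure. *)
Lemma integral_increment T B (s t : R)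
    (H : g_sigma_algebraType (past_events B s) * R -> \bar R) :
  standard_brownian_motion T B -> 0 <= s -> s < t -> t <= T ->
  measurable_fun setT H -> (forall p, 0 <= H p)%E ->
  (\int[P]_w H (w, increment B s t w) =
   \int[P]_w \int[gauss (Num.sqrt (t - s))]_z H (w, z))%E.
Proof.
move=> [_ _ law indep] s0 st tT mH H0.
pose F := g_sigma_algebraType (past_events B s).
pose sigma := Num.sqrt (t - s).
have mid : measurable_fun [set: Omega] (idfun : Omega -> F).
  by move=> _ A mA; rewrite setTI; exact: (filtration_measurable B s).
pose X : {mfun Omega >-> F} := HB.pack (idfun : Omega -> F)
  (isMeasurableFun.Build _ _ _ _ _ mid).
have mincr : measurable_fun [set: Omega] (increment B s t).
  exact: measurable_funB.
pose pair w : F * measurableTypeR R := (w, increment B s t w).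
have mpair : measurable_fun [set: Omega] pair.
  exact: measurable_fun_pair.
pose Y : {mfun Omega >-> (F * measurableTypeR R)%type} := HB.pack pair
  (isMeasurableFun.Build _ _ _ _ _ mpair).
transitivity (\int[distribution P Y]_p H p)%E.
  by rewrite ge0_integral_distribution.
transitivity (\int[(distribution P X) \x (gauss sigma)]_p H p)%E.
  (* It suffices to compare the two measures on rectangles, where [indep] factors the probability
     and [law] identifies the Gaussian factor. *)
  apply: eq_measure_integral => A mA _.
  apply/esym/product_measure_unique => // C D mC mD.
  rewrite /= /distribution /pushforward/= -law//.
  rewrite [RHS]muleC -indep//.
  by congr (P _); apply/seteqP; split => w /= [].
rewrite fubini_tonelli1// ge0_integral_distribution//.
  exact: measurable_fun_fubini_tonelli_F.
by move=> w; exact: integral_ge0.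
Qed.

Lemma measurable_adapted B (s : R) (f : Omega -> R) : adapted B s f ->
  measurable_fun setT
    (fun p : g_sigma_algebraType (past_events B s) * R => f p.1).
Proof. by move=> mf; apply: (measurableT_comp mf). Qed.

(** * Chaining the entropy inequality along the time grid *)

(** Given the past at [s], the values of [Y] and [a] are frozen and the increment is Gaussian of
    variance [t - s], so [gauss_drift_le] applies pointwise. *)
Lemma entropy_step T B (s t M : R) (g : R -> R) (Y a : Omega -> R) :
  standard_brownian_motion T B -> 0 <= s -> s < t -> t <= T ->
  weight M g -> adapted B s Y -> adapted B s a ->
  (\int[P]_w (ln (g (Y w + a w + increment B s t w)))%:E <=
   \int[P]_w (ln (heat (Num.sqrt (t - s)) g (Y w)))%:E
     + \int[P]_w (a w ^+ 2 / (2 * (t - s)))%:E)%E.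
Proof.
move=> hB s0 st tT gM mY ma; have [mg g1M] := gM.
have [mh h1M] := heat_weight (Num.sqrt (t - s)) _ _ gM.
have lng0 z : (0 <= (ln (g z))%:E)%E.
  by have /andP[g1 _] := g1M z; rewrite lee_fin ln_ge0.
have lnh0 z : (0 <= (ln (heat (Num.sqrt (t - s)) g z))%:E)%E.
  by have /andP[h1 _] := h1M z; rewrite lee_fin ln_ge0.
have a0 w : (0 <= (a w ^+ 2 / (2 * (t - s)))%:E)%E.
  by rewrite lee_fin divr_ge0 ?sqr_ge0// mulr_ge0// subr_ge0 ltW.
have mlnh : measurable_fun setT (fun w => (ln (heat (Num.sqrt (t - s)) g (Y w)))%:E).
  apply/measurable_EFinP; apply: measurableT_comp; first exact: measurable_ln.
  by apply: measurableT_comp => //; exact: adapted_measurable mY.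
have masq : measurable_fun setT (fun w => (a w ^+ 2 / (2 * (t - s)))%:E).
  apply/measurable_EFinP; apply: measurable_funM => //.
  by apply: measurable_funX; exact: adapted_measurable ma.
rewrite -ge0_integralD//.
pose H (p : g_sigma_algebraType (past_events B s) * R) :=
  (ln (g (Y p.1 + a p.1 + p.2)))%:E.
have mH : measurable_fun setT H.
  apply/measurable_EFinP; apply: measurableT_comp; first exact: measurable_ln.
  apply: measurableT_comp => //; apply: measurable_funD => //.
  by apply: measurable_funD; exact: measurable_adapted.
rewrite (integral_increment _ _ _ _ H hB s0 st tT mH (fun=> lng0 _)).
apply: ge0_le_integral => //.
- by move=> w _; apply: integral_ge0 => z _; exact: lng0.
- apply: (filtration_measurable_fun _ _ B s).
  exact: (measurable_fun_fubini_tonelli_F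
    (m2 := gauss (Num.sqrt (t - s))) H mH (fun=> lng0 _)).
- exact: emeasurable_funD.
- move=> w _; rewrite -EFinD.
  have := gauss_drift_le (Num.sqrt (t - s)) (a w) (Y w) M g.
  rewrite sqrtr_gt0 subr_gt0 sqr_sqrtr ?subr_ge0 ?(ltW st)//; exact.
Qed.

Lemma heat_step T B (s t M : R) (g : R -> R) (Y : Omega -> R) :
  standard_brownian_motion T B -> 0 <= s -> s < t -> t <= T ->
  weight M g -> adapted B s Y ->
  (\int[P]_w (g (Y w + increment B s t w))%:E =
   \int[P]_w (heat (Num.sqrt (t - s)) g (Y w))%:E)%E.
Proof.
move=> hB s0 st tT gM mY; have [mg g1M] := gM.
have mH : measurable_fun setT
    (fun p : g_sigma_algebraType (past_events B s) * R => (g (Y p.1 + p.2))%:E).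
  apply/measurable_EFinP; apply: measurableT_comp => //.
  by apply: measurable_funD => //; exact: measurable_adapted.
rewrite (integral_increment _ _ _ _ _ hB s0 st tT mH)//; last first.
  move=> p; have /andP[g1 _] := g1M (Y p.1 + p.2).
  by rewrite lee_fin (le_trans _ g1).
by apply: eq_integral => w _; rewrite (heatE _ _ _ _ gM).
Qed.

Lemma iter_heat_weight (s M : R) (g : R -> R) n :
  weight M g -> weight M (iter n (heat s) g).
Proof. by move=> gM; elim: n => //= n; exact: heat_weight. Qed.

Lemma adapted_partial_sum B (h : R) n (a : nat -> Omega -> R) : 0 < h ->
  (forall k, (k < n)%N -> adapted B (k%:R * h) (a k)) ->
  adapted B (n%:R * h) (fun w => B (n%:R * h) w + \sum_(k < n) a k w).
Proof.
move=> h0 ma; apply: measurable_funD.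
  by apply: adapted_path; rewrite mulr_ge0 ?(ltW h0)//=.
(* Retyping the summands makes [measurable_sum] work over the past at [n%:R * h] rather than over
   [Omega]. *)
pose a' k : g_sigma_algebraType (past_events B (n%:R * h)) -> R := a k.
have -> : (fun w => \sum_(k < n) a k w) = (fun w => \sum_(k < n) a' k w) by [].
apply: measurable_sum => k; apply: (adaptedS B (k%:R * h)); last exact: ma.
by rewrite ler_pM2r// ler_nat ltnW.
Qed.

(** Induction on [n] for all weights at once: integrating out the last increment replaces [g] by
    [heat (Num.sqrt h) g], a weight with the same bound. *)
Lemma entropy_chain T B (h M : R) n (g : R -> R) (a : nat -> Omega -> R) :
  standard_brownian_motion T B -> 0 < h -> n%:R * h <= T -> weight M g ->
  (forall k, (k < n)%N -> adapted B (k%:R * h) (a k)) ->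
  (\int[P]_w (ln (g (B (n%:R * h)%R w + \sum_(k < n) a k w)))%:E <=
   \int[P]_w (ln (iter n (heat (Num.sqrt h)) g (B 0%R w)))%:E
     + \sum_(k < n) \int[P]_w (a k w ^+ 2 / (2 * h))%:E)%E.
Proof.
move=> hB h0; elim: n g => [|n IH] g nT gM ma.
  rewrite big_ord0 adde0.
  by under eq_integral do rewrite big_ord0 addr0 mul0r.
have dh : n.+1%:R * h - n%:R * h = h by rewrite -mulrBl -natrB// subSnn mul1r.
have t0 : 0 <= n%:R * h by rewrite mulr_ge0 ?(ltW h0).
have tt : n%:R * h < n.+1%:R * h by rewrite ltr_pM2r// ltr_nat.
have ma' k : (k < n)%N -> adapted B (k%:R * h) (a k).
  by move=> kn; apply: ma; exact: ltnW.
have := entropy_step T B _ _ M g _ (a n) hB t0 tt nT gM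
  (adapted_partial_sum B h n a h0 ma') (ma n (ltnSn n)).
rewrite dh => step.
have -> : (\int[P]_w (ln (g (B (n.+1%:R * h)%R w + \sum_(k < n.+1) a k w)))%:E =
  \int[P]_w (ln (g (B (n%:R * h)%R w + \sum_(k < n) a k w + a n w
    + increment B (n%:R * h) (n.+1%:R * h) w)))%:E)%E.
  apply: eq_integral => w _; congr (ln (g _))%:E.
  by rewrite big_ord_recr/= /increment; ring.
rewrite iterSr big_ord_recr addeA.
apply: (le_trans step); apply: leeD => //.
apply: IH => //; first exact: le_trans (ltW tt) nT.
exact: heat_weight.
Qed.

(** The drift-free counterpart, with equality; it identifies the iterated heat term left over by
    [entropy_chain]. *)
Lemma heat_chain T B (h M : R) n (g : R -> R) :
  standard_brownian_motion T B -> 0 < h -> n%:R * h <= T -> weight M g ->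
  (\int[P]_w (g (B (n%:R * h)%R w))%:E =
   \int[P]_w (iter n (heat (Num.sqrt h)) g (B 0%R w))%:E)%E.
Proof.
move=> hB h0; elim: n g => [|n IH] g nT gM; first by rewrite mul0r.
have dh : n.+1%:R * h - n%:R * h = h by rewrite -mulrBl -natrB// subSnn mul1r.
have t0 : 0 <= n%:R * h by rewrite mulr_ge0 ?(ltW h0).
have tt : n%:R * h < n.+1%:R * h by rewrite ltr_pM2r// ltr_nat.
rewrite iterSr -IH; [|exact: le_trans (ltW tt) nT|exact: heat_weight].
have tt0 : 0 <= n%:R * h <= n%:R * h by rewrite t0/=.
have := heat_step T B _ _ M g _ hB t0 tt nT gM (adapted_path B _ _ tt0).
rewrite dh => <-; apply: eq_integral => w _; congr (g _)%:E.
by rewrite /increment addrC subrK.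
Qed.

(** Since [B 0] is almost surely [0], the iterate [G] is evaluated at the single point [0]: the
    entropy term is [ln (G 0)], and [G 0] is the mean of [g (B T)]. *)
Lemma entropy_bound T B (M : R) n (g : R -> R) (a : nat -> Omega -> R) :
  0 < T -> standard_brownian_motion T B -> weight M g ->
  (forall k, (k <= n)%N -> adapted B (k%:R * (T / n.+1%:R)) (a k)) ->
  (\int[P]_w (ln (g (B T w + \sum_(k < n.+1) a k w)))%:E <=
   (ln (\int[P]_w g (B T w)))%:E
     + \sum_(k < n.+1) \int[P]_w (a k w ^+ 2 / (2 * (T / n.+1%:R)))%:E)%E.
Proof.
move=> T0 hB gM ma; set h := T / n.+1%:R.
have h0 : 0 < h by rewrite divr_gt0.
have hT : n.+1%:R * h = T by rewrite mulrC divfK.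
have [B00 _ _ _] := hB.
set G := iter n.+1 (heat (Num.sqrt h)) g.
have [mG G1] : weight M G by exact: iter_heat_weight.
have atzero (f : R -> \bar R) : measurable_fun setT f ->
    (\int[P]_w f (B 0%R w) = f 0%R)%E.
  move=> mf; transitivity (\int[P]_w (cst (f 0%R) w))%E.
    apply: ae_eq_integral => //; first exact: measurableT_comp.
    by apply: filterS B00 => w ->.
  by rewrite integral_cst// -[RHS]mule1; congr (_ * _)%E; exact: probability_setT.
have := entropy_chain T B h M n.+1 g a hB h0 _ gM ma.
rewrite hT => /(_ (lexx _)).
rewrite -/G [X in (_ <= X + _)%E](atzero (fun x => (ln (G x))%:E)); last first.
  by apply/measurable_EFinP; apply: measurableT_comp => //; exact: measurable_ln.
have := heat_chain T B h M n.+1 g hB h0 _ gM.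
rewrite hT => /(_ (lexx _)).
rewrite -/G [X in _ = X -> _](atzero (fun x => (G x)%:E)); last exact/measurable_EFinP.
by rewrite /Rintegral => ->.
Qed.

(** * The drift and its energy *)

Definition drift alpha (t : R) (w : Omega) : R :=
  \int[mu]_(s in `[0, t]) alpha s w.

(** Progressive measurability at time [t] is exactly the joint measurability over [[0, t]] and the
    past at [t] that a fiber integral requires. *)
Lemma drift_adapted T B alpha t : progressively_measurable T B alpha ->
  0 <= t <= T -> adapted B t (drift alpha t).
Proof.
move=> mprog tT; have ma := mprog t tT.
apply: measurableT_comp => //.
apply: (measurable_fun_fiber_integral _ _ `[0, t]%classic
  (fun p : R * g_sigma_algebraType (past_events B t) => (alpha p.1 p.2)%:E)) => //.
exact/measurable_EFinP.
Qed.

Lemma measurable_process T B alpha : 0 <= T ->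
  progressively_measurable T B alpha ->
  measurable_fun (`[0, T] `*` setT) (fun p : R * Omega => alpha p.1 p.2).
Proof.
move=> T0 mprog; have TT : 0 <= T <= T by rewrite T0 lexx.
have ma := mprog T TT.
pose phi (p : R * Omega) : R * g_sigma_algebraType (past_events B T) := (p.1, p.2).
apply: (measurable_comp (g := phi) _ _ ma) => //.
- exact: measurableX.
- by move=> _ [p [? ?] <-].
- apply: measurable_funTS; apply: measurable_fun_pair => //.
  move=> _ A mA; rewrite setTI.
  rewrite (_ : _ @^-1` A = setT `*` A); last by apply/seteqP; split => p /=; [|case].
  apply: measurableX => //; exact: filtration_measurable mA.
Qed.

Lemma second_moment_le T B alpha t : admissible T B alpha -> 0 <= t <= T ->
  (\int[P]_w (alpha t w ^+ 2)%:E <= (2 / pi)%:E)%E.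
Proof.
move=> [_ adm] tT.
have -> : (\int[P]_w (alpha t w ^+ 2)%:E = 'N[P]_2%:E [EFin \o alpha t] `^ 2)%E.
  rewrite powR_Lnorm//; apply: eq_integral => w _ /=.
  by rewrite powR_mulrn// real_normK// num_real.
have c0 : 0 <= 2 / pi :> R by rewrite divr_ge0// pi_ge0.
have -> : (2 / pi)%:E = ((Num.sqrt (2 / pi))%:E `^ 2)%E :> \bar R.
  by rewrite poweR_EFin powR_mulrn// sqr_sqrtr.
apply: gt0_ler_poweR => //; last exact: adm.
- by rewrite in_itv/= Lnorm_ge0 leey.
- by rewrite in_itv/= lee_fin sqrtr_ge0 leey.
Qed.

(** Tonelli exchanges expectation and time, and the constraint bounds the second moment at each time
    by [2 / pi]. *)
Lemma energy_le T B alpha (D : set R) (L : R) : 0 <= T -> admissible T B alpha ->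
  measurable D -> D `<=` `[0, T] -> mu D = L%:E ->
  (\int[P]_w \int[mu]_(x in D) (alpha x w ^+ 2)%:E <= (L * (2 / pi))%:E)%E.
Proof.
move=> T0 adm mD DT muD; have [mprog _] := adm.
have msq : measurable_fun (D `*` setT) (fun p : R * Omega => (alpha p.1 p.2 ^+ 2)%:E).
  apply/measurable_EFinP; apply: measurable_funX.
  apply: measurable_funS (measurable_process T B alpha T0 mprog).
    exact: measurableX.
  by move=> p [/DT].
rewrite (ge0_fiber_integral_swap _ _ P D
  (fun p : R * Omega => (alpha p.1 p.2 ^+ 2)%:E))//; last first.
  by move=> p; rewrite lee_fin sqr_ge0.
apply: (@le_trans _ _ (\int[mu]_(x in D) (2 / pi)%:E)%E).
  apply: ge0_le_integral => //.
  - by move=> x _; apply: integral_ge0 => w _; rewrite lee_fin sqr_ge0.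
  - pose f (p : R * Omega) := (alpha p.1 p.2 ^+ 2)%:E.
    pose g := (f \_ (D `*` setT))%E.
    have mg : measurable_fun setT g.
      by apply/(measurable_restrictT _ _).1 => //; exact: measurableX.
    have g0 p : (0 <= g p)%E.
      by rewrite /g patchE; case: ifP => // _; rewrite lee_fin sqr_ge0.
    apply: (eq_measurable_fun (fubini_F P g)).
      move=> x xD; apply: eq_integral => w _.
      by rewrite /g patchE ifT// inE; split => //; exact: set_mem.
    by apply: measurable_funTS; exact: measurable_fun_fubini_tonelli_F.
  - move=> x /DT; rewrite /= in_itv/= => xT; exact: second_moment_le adm xT.
by rewrite integral_cst//= muD -EFinM mulrC.
Qed.

(** One factor [t - s] comes from Cauchy-Schwarz along each path, the other from the energy over
    []s, t]]. *)
Lemma drift_increment_le T B alpha (s t : R) : admissible T B alpha ->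
  0 <= s -> s < t -> t <= T ->
  (\int[P]_w ((drift alpha t w - drift alpha s w) ^+ 2)%:E
    <= ((t - s) ^+ 2 * (2 / pi))%:E)%E.
Proof.
move=> adm s0 st tT; have [mprog _] := adm.
have t0 : 0 <= t by rewrite (le_trans s0)// ltW.
have T0 : 0 <= T by rewrite (le_trans t0).
have L0 : 0 < t - s by rewrite subr_gt0.
have mu0t : mu `[0, t] = t%:E.
  rewrite lebesgue_measure_itv/= lte_fin (le_lt_trans s0 st).
  by rewrite -EFinD subr0.
have must : mu `]s, t] = (t - s)%:E.
  by rewrite lebesgue_measure_itv/= lte_fin st -EFinD.
have sub0 : `[0, t] `<=` `[0, T].
  by apply: subset_itvl; rewrite bnd_simp.
have sub1 : `]s, t] `<=` `[0, t].
  by apply: subset_itvr; rewrite bnd_simp.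
have mproc := measurable_process T B alpha T0 mprog.
have msq (D : set R) : measurable D -> D `<=` `[0, T] ->
  measurable_fun setT (fun w => \int[mu]_(x in D) (alpha x w ^+ 2)%:E)%E.
  move=> mD DT; apply: (measurable_fun_ge0_fiber_integral _ _ D
    (fun p : R * Omega => (alpha p.1 p.2 ^+ 2)%:E)) => //.
    apply/measurable_EFinP; apply: measurable_funX.
    apply: measurable_funS mproc; first exact: measurableX.
    by move=> p [/DT].
  by move=> p; rewrite lee_fin sqr_ge0.
have mfib w : measurable_fun `[0, t] (fun x => alpha x w).
  apply: (measurable_comp (g := fun x => (x, w)) _ _ mproc).
  - exact: measurableX.
  - by move=> _ [x /sub0 ? <-].
  - by apply: measurable_funTS; apply: measurable_fun_pair => //; exact: measurable_cst.
(* Finite expected energy makes almost every path square integrable on [[0, t]]; the pathwise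
   estimate is made for these only. *)
have finae : \forall w \ae P,
    (\int[mu]_(x in `[0%R, t]) (alpha x w ^+ 2)%:E < +oo)%E.
  have sq0 w : (0 <= \int[mu]_(x in `[0%R, t]) (alpha x w ^+ 2)%:E)%E.
    by apply: integral_ge0 => x _; rewrite lee_fin sqr_ge0.
  have ien : P.-integrable setT
      (fun w => \int[mu]_(x in `[0%R, t]) (alpha x w ^+ 2)%:E)%E.
    apply/integrableP; split; first exact: msq.
    under eq_integral do rewrite gee0_abs//.
    have := energy_le T B alpha _ _ T0 adm (measurable_itv `[0, t]) sub0 mu0t.
    by move/le_lt_trans; apply; exact: ltry.
  apply: filterS (integrable_ae measurableT ien) => w /(_ I).
  by rewrite ge0_fin_numE.
apply: (@le_trans _ _
  (\int[P]_w ((t - s)%:E * \int[mu]_(x in `]s, t]) (alpha x w ^+ 2)%:E))%E).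
  apply: ae_ge0_le_integral => //.
  - by move=> w _; rewrite lee_fin sqr_ge0.
  - apply/measurable_EFinP; apply: measurable_funX; apply: measurable_funB.
      apply: (adapted_measurable B t); apply: drift_adapted mprog _.
      by rewrite t0.
    apply: (adapted_measurable B s); apply: drift_adapted mprog _.
    by rewrite s0 (le_trans (ltW st)).
  - move=> w _; rewrite mule_ge0 ?lee_fin ?(ltW L0)//.
    by apply: integral_ge0 => x _; rewrite lee_fin sqr_ge0.
  - by apply: measurable_funeM; apply: msq => //; exact: subset_trans sub1 sub0.
  apply: filterS finae => w fin _.
  have isq : mu.-integrable `[0, t] (EFin \o (fun x => alpha x w ^+ 2)).
    apply/integrableP; split.
      apply/measurable_EFinP; apply: measurable_funX; exact: mfib.
    by under eq_integral do rewrite /= ger0_norm ?sqr_ge0//.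
  (* From [|x| <= 1 + x ^+ 2] on an interval of finite length. Integrability is what lets the two
     drifts be subtracted as one integral over []s, t]]. *)
  have i1 : mu.-integrable `[0, t] (EFin \o (fun x => alpha x w)).
    have icst : mu.-integrable `[0, t] (EFin \o (fun=> 1)).
      apply/integrableP; split; first exact: measurable_cst.
      rewrite (eq_integral (cst 1%E)); last by move=> x _; rewrite /= normr1.
      by rewrite integral_cst//= mu0t mul1e ltry.
    apply: le_integrable (integrableD _ icst isq) => //.
      by apply/measurable_EFinP; exact: mfib.
    move=> x _; rewrite lee_fin/= [leRHS]ger0_norm ?addr_ge0 ?sqr_ge0// ler_norml.
    by apply/andP; split; nra.
  have s0b : (BLeft 0 <= BRight s)%O by rewrite bnd_simp.
  have stb : (BRight s <= BRight t)%O by rewrite bnd_simp ltW.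
  rewrite /drift (Rintegral_itvB i1 s0b stb).
  have isq' : mu.-integrable `]s, t] (EFin \o (fun x => alpha x w ^+ 2)).
    exact: integrableS isq.
  have i1' : mu.-integrable `]s, t] (EFin \o (fun x => alpha x w)).
    exact: integrableS i1.
  apply: le_trans (_ : ((t - s) * \int[mu]_(x in `]s, t]) alpha x w ^+ 2)%:E <= _)%E.
    by rewrite lee_fin; exact: sqr_Rintegral_le.
  rewrite EFinM /Rintegral fineK//.
  exact: integrable_fin_num.
rewrite ge0_integralZl//; last 3 first.
- by apply: msq => //; exact: subset_trans sub1 sub0.
- by move=> w _; apply: integral_ge0 => x _; rewrite lee_fin sqr_ge0.
- by rewrite lee_fin ltW.
rewrite expr2 -mulrA EFinM; apply: lee_wpmul2l; first by rewrite lee_fin ltW.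
by apply: (energy_le T B alpha) => //; exact: subset_trans sub1 sub0.
Qed.

Lemma brownian_symmetric_itv T B (r : R) : 0 < T -> 0 <= r ->
  standard_brownian_motion T B ->
  P (B T @^-1` `[- r, r]) = (2 * Phi (r / Num.sqrt T) - 1)%:E.
Proof.
move=> T0 r0 [B00 _ law _]; set A := `[- r, r]%classic.
have sT : 0 < Num.sqrt T by rewrite sqrtr_gt0.
have mincr : measurable_fun [set: Omega] (increment B 0 T) by exact: measurable_funB.
have mA : measurable A by exact: measurable_itv.
have mpre (f : Omega -> R) : measurable_fun setT f -> measurable (f @^-1` A).
  by move=> mf; rewrite -[X in measurable X]setTI; exact: mf.
transitivity (P (increment B 0 T @^-1` A)).
  (* [B T] equals the increment from [0] only almost surely, so the probabilities are compared as
     integrals of indicators. *)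
  have indE (f : Omega -> R) : measurable_fun setT f ->
      (\int[P]_w (\1_A (f w))%:E = P (f @^-1` A))%E.
    move=> mf; rewrite -[RHS](_ : \int[P]_w (\1_(f @^-1` A) w)%:E = _)%E.
      by apply: eq_integral => w _; rewrite !indicE.
    by rewrite integral_indic// ?setIT//; exact: mpre.
  rewrite -!indE//; apply: ae_eq_integral => //.
  - by apply/measurable_EFinP; apply: measurableT_comp => //; exact: measurable_indic.
  - by apply/measurable_EFinP; apply: measurableT_comp => //; exact: measurable_indic.
  - by apply: filterS B00 => w B0 _; rewrite /increment B0 subr0.
rewrite law// subr0 gauss_scale// -gauss_symmetric_itv; last first.
  by rewrite divr_ge0// ltW.
congr (normal_prob _ _ _); apply/seteqP; split => x; rewrite /A /=!in_itv/=.
  by move=> /andP[? ?]; rewrite -mulNr ler_pdivrMr// ler_pdivlMr// ![x * _]mulrC; apply/andP.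
by rewrite -mulNr ler_pdivrMr// ler_pdivlMr// ![x * _]mulrC.
Qed.

(* The delayed displacement; as [0.-1 = 0], it vanishes for [k = 0]. *)
Definition drift_step alpha (h : R) (k : nat) (w : Omega) : R :=
  drift alpha (k%:R * h) w - drift alpha (k.-1%:R * h) w.

Lemma drift_step_adapted T B alpha (h : R) k :
  progressively_measurable T B alpha -> 0 <= h -> k%:R * h <= T ->
  adapted B (k%:R * h) (drift_step alpha h k).
Proof.
move=> mprog h0 kT.
have kk : k.-1%:R * h <= k%:R * h by rewrite ler_wpM2r// ler_nat leq_pred.
apply: measurable_funB; first by apply: drift_adapted mprog _; rewrite mulr_ge0.
apply: (adaptedS B (k.-1%:R * h)) => //; apply: drift_adapted mprog _.
by apply/andP; split; [exact: mulr_ge0|exact: le_trans kk kT].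
Qed.

(** A squared displacement of mean at most [h ^+ 2 * (2 / pi)], divided by [2 * h], costs [h / pi];
    the steps of the grid then add up to [T / pi]. *)
Lemma drift_step_cost_le T B alpha (h : R) k :
  admissible T B alpha -> 0 < h -> k%:R * h <= T ->
  (\int[P]_w (drift_step alpha h k w ^+ 2 / (2 * h))%:E <= (h / pi)%:E)%E.
Proof.
move=> adm h0 kT; have [mprog _] := adm.
have pi0 : 0 < pi :> R := pi_gt0 R.
case: k kT => [|k] kT.
  rewrite integral0_eq; first by rewrite lee_fin divr_ge0 ?ltW.
  by move=> w _; rewrite /drift_step subrr expr0n mul0r.
have dh : k.+1%:R * h - k%:R * h = h by rewrite -mulrBl -natrB// subSnn mul1r.
have kk : k%:R * h < k.+1%:R * h by rewrite ltr_pM2r// ltr_nat.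
have k0 : 0 <= k%:R * h by rewrite mulr_ge0 ?(ltW h0).
have := drift_increment_le T B alpha _ _ adm k0 kk kT.
rewrite dh => le.
have masq : measurable_fun setT (fun w => (drift_step alpha h k.+1 w ^+ 2)%:E).
  apply/measurable_EFinP; apply: measurable_funX.
  apply: (adapted_measurable B (k.+1%:R * h)).
  exact: drift_step_adapted mprog (ltW h0) kT.
under eq_integral do rewrite mulrC EFinM.
rewrite ge0_integralZl//; last 2 first.
- by move=> w _; rewrite lee_fin sqr_ge0.
- by rewrite lee_fin invr_ge0 mulr_ge0 ?ltW.
apply: le_trans (_ : ((2 * h)^-1 * (h ^+ 2 * (2 / pi)))%:E <= _)%E.
  by rewrite [leRHS]EFinM lee_wpmul2l// lee_fin invr_ge0 mulr_ge0 ?ltW.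
rewrite lee_fin le_eqVlt; apply/orP; left; apply/eqP.
by move: (pi : R) pi0 => q q0; field; rewrite (gt_eqF q0) (gt_eqF h0).
Qed.

(** The sum telescopes. As the step of index [0] is zero, [n.+1] steps collect the drift up to
    [n%:R * h] only, one step late. *)
Lemma sum_drift_step alpha (h : R) n w :
  \sum_(k < n.+1) drift_step alpha h k w = drift alpha (n%:R * h) w.
Proof.
have drift0 : drift alpha 0 w = 0 by rewrite /drift set_itv1 /Rintegral integral_set1.
elim: n => [|n IH]; first by rewrite big_ord1 /drift_step subrr mul0r drift0.
by rewrite big_ord_recr IH /drift_step/= addrC subrK.
Qed.

(** * The tilted indicator and the passage to the limit *)

Definition tilt (lam : R) (A : set R) (x : R) : R := expR (lam * \1_A x).

Lemma tilt_weight (lam : R) (A : set R) : 0 <= lam -> measurable A ->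
  weight (expR lam) (tilt lam A).
Proof.
move=> lam0 mA; split.
  by apply: measurableT_comp => //; exact: measurable_funM.
move=> x; rewrite /tilt indicE; case: (x \in A) => /=.
  by rewrite mulr1 lexx andbT -[leLHS]expR0 ler_expR.
by rewrite mulr0 expR0 lexx/= -[leLHS]expR0 ler_expR.
Qed.

(** Pointwise, [tilt lam A] is at most [1] plus [expR lam] times the indicator. The lower bound
    keeps the argument of the logarithm positive. *)
Lemma integral_tilt_bounds (lam : R) (A : set R) (X : {RV P >-> R}) : 0 <= lam ->
  measurable A ->
  1 <= \int[P]_w tilt lam A (X w) <= 1 + expR lam * fine (P (X @^-1` A)).
Proof.
move=> lam0 mA.
have mpre : measurable (X @^-1` A) by exact: measurable_funPTI.
have iind : P.-integrable setT (EFin \o (fun w => expR lam * \1_(X @^-1` A) w)).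
  apply: (bounded_integrable _ _ _ (expR lam)).
    by apply: measurable_funM => //; exact: measurable_indic.
  move=> w; rewrite ger0_norm ?mulr_ge0 ?expR_ge0// indicE.
  by case: (_ \in _) => /=; rewrite ?mulr1// mulr0 expR_ge0.
have icst : P.-integrable setT (EFin \o (fun=> 1)).
  exact: finite_measure_integrable_cst.
have isum : P.-integrable setT
    (EFin \o (fun w => 1 + expR lam * \1_(X @^-1` A) w)).
  by apply: eq_integrable (integrableD measurableT icst iind).
have [mtilt tiltM] := tilt_weight lam A lam0 mA.
have itilt : P.-integrable setT (EFin \o (fun w => tilt lam A (X w))).
  apply: (bounded_integrable _ _ _ (expR lam)); first exact: measurableT_comp.
  by move=> w; rewrite ger0_norm ?expR_ge0//; have /andP[] := tiltM (X w).
have int1 : \int[P]_w (1 : R) = 1.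
  rewrite Rintegral_cst// mul1r.
  by have -> : fine (P setT) = 1 by rewrite probability_setT.
apply/andP; split.
  rewrite -[leLHS]int1; apply: le_Rintegral => // w _.
  by have /andP[] := tiltM (X w).
apply: le_trans (le_Rintegral measurableT itilt isum _) _.
  move=> w _; rewrite /tilt !indicE.
  have -> : (w \in X @^-1` A) = (X w \in A) by [].
  case: (_ \in _) => /=; first by rewrite !mulr1 lerDr.
  by rewrite !mulr0 expR0 addr0.
rewrite (RintegralD measurableT icst iind) int1.
rewrite RintegralZl//; last first.
  apply: (bounded_integrable _ _ _ 1); first exact: measurable_indic.
  by move=> w; rewrite indicE ger0_norm// lern1 leq_b1.
by rewrite /Rintegral integral_indic// setIT.
Qed.

Lemma terminal_valueE T B alpha w :
  terminal_value T B alpha w = drift alpha T w + B T w.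
Proof. by []. Qed.

(** The entropy bound for [tilt lam A] controls [lam] times the probability that the delayed value
    lies in [A], giving the first two terms; Chebyshev on the missing piece of drift gives the
    third. *)
Lemma entropy_ball_step T B alpha (V eps lam : R) n : 0 < T ->
  standard_brownian_motion T B -> admissible T B alpha ->
  (\forall w \ae P, `|terminal_value T B alpha w| <= V) ->
  0 < eps -> 0 < lam ->
  lam <= ln (1 + expR lam * fine (P (B T @^-1` `[- (V + eps), V + eps]))) + T / pi
    + lam * ((T / n.+1%:R) ^+ 2 * (2 / pi) / eps ^+ 2).
Proof.
move=> T0 hB adm XV eps0 lam0; have [mprog _] := adm.
set r := V + eps; set A := `[- r, r]%classic; set h := T / n.+1%:R.
have mA : measurable A by exact: measurable_itv.
have h0 : 0 < h by rewrite divr_gt0.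
have hT : n.+1%:R * h = T by rewrite mulrC divfK.
have kT k : (k <= n.+1)%N -> k%:R * h <= T.
  by move=> kn; rewrite -hT ler_wpM2r ?ler_nat// ltW.
have n0 : 0 <= n%:R * h by rewrite mulr_ge0 ?(ltW h0).
have ma k : (k <= n)%N -> adapted B (k%:R * h) (drift_step alpha h k).
  by move=> kn; apply: drift_step_adapted mprog (ltW h0) (kT k _); exact: leqW.
have wt := tilt_weight lam A (ltW lam0) mA.
have := entropy_bound T B _ n _ (drift_step alpha h) T0 hB wt ma.
(* [Y] is the delayed terminal value and [D] the drift over the last step, so that [Y + D] is the
   terminal value. *)
pose Y w := B T w + drift alpha (n%:R * h) w.
pose D w := drift alpha T w - drift alpha (n%:R * h) w.
have mdrift t : 0 <= t <= T -> measurable_fun setT (drift alpha t).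
  by move=> tT; apply: (adapted_measurable B t); exact: drift_adapted mprog tT.
have mD : measurable_fun setT D.
  by apply: measurable_funB; apply: mdrift; rewrite ?lexx ?(ltW T0)// n0 kT.
have mY : measurable_fun setT Y.
  by apply: measurable_funD => //; apply: mdrift; rewrite n0 kT.
have mind : measurable_fun setT (fun w => \1_A (Y w) : R).
  by apply: measurableT_comp => //; exact: measurable_indic.
have mindE : measurable_fun setT (fun w => (\1_A (Y w) : R)%:E).
  by apply/measurable_EFinP; exact: mind.
have ind0 w : (0 <= (\1_A (Y w) : R)%:E)%E by rewrite lee_fin.
have mD2 : measurable_fun setT (fun w => (D w ^+ 2)%:E).
  by apply/measurable_EFinP; exact: measurable_funX.
have D20 w : (0 <= (D w ^+ 2)%:E)%E by rewrite lee_fin sqr_ge0.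
have e0 : (0 <= ((eps ^+ 2)^-1)%:E)%E by rewrite lee_fin invr_ge0 sqr_ge0.
have mD2s : measurable_fun setT (fun w => ((eps ^+ 2)^-1)%:E * (D w ^+ 2)%:E)%E.
  exact: measurable_funeM.
have D2s0 w : (0 <= ((eps ^+ 2)^-1)%:E * (D w ^+ 2)%:E)%E by exact: mule_ge0.
have -> : (\int[P]_w (ln (tilt lam A
    (B T w + \sum_(k < n.+1) drift_step alpha h k w)))%:E
    = lam%:E * \int[P]_w (\1_A (Y w))%:E)%E.
  rewrite -ge0_integralZl//; last by rewrite lee_fin ltW.
  by apply: eq_integral => w _; rewrite sum_drift_step /tilt expRK EFinM.
have cost : (\sum_(k < n.+1) \int[P]_w
    (drift_step alpha h k w ^+ 2 / (2 * h))%:E <= (T / pi)%:E)%E.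
  apply: le_trans (_ : \sum_(k < n.+1) (h / pi)%:E <= _)%E.
    apply: lee_sum => k _; apply: (drift_step_cost_le T B) => //.
    by apply: kT; apply: ltnW.
  by rewrite sumEFin lee_fin sumr_const card_ord -mulr_natl mulrA hT.
(* If [|Y| > V + eps] while [|Y + D| <= V], then [|D| >= eps]. *)
have tail : (1 <= \int[P]_w (\1_A (Y w))%:E
    + (h ^+ 2 * (2 / pi) / eps ^+ 2)%:E)%E.
  apply: (@le_trans _ _ (\int[P]_w ((\1_A (Y w))%:E
      + ((eps ^+ 2)^-1)%:E * (D w ^+ 2)%:E))%E).
    have -> : (1%E = \int[P]_w (cst 1%E : Omega -> \bar R) w)%E.
      by rewrite integral_cst// mul1e; exact/esym/probability_setT.
    apply: ae_ge0_le_integral => //.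
    - by move=> w _; exact: adde_ge0.
    - exact: emeasurable_funD.
    apply: filterS XV => w; rewrite terminal_valueE => Xw _.
    rewrite -EFinM -EFinD lee_fin indicE.
    have [Yw|] := boolP (Y w \in A).
      by rewrite lerDl mulr_ge0// ?invr_ge0 sqr_ge0.
    rewrite notin_setE /A/= in_itv/= -ler_norml => /negP; rewrite -ltNge => rY.
    rewrite add0r mulrC ler_pdivlMr ?exprn_gt0// mul1r.
    have XE : drift alpha T w + B T w = Y w + D w by rewrite /Y /D; ring.
    have : eps <= `|D w|.
      rewrite XE in Xw; have := ler_normB (Y w + D w) (D w); rewrite addrK.
      by rewrite /r in rY; lra.
    by move=> epsD; rewrite -(real_normK (num_real (D w))) ler_sqr ?nnegrE ?(ltW eps0).
  rewrite ge0_integralD//.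
  apply: leeD => //.
  have nT : n%:R * h < T by rewrite -hT ltr_pM2r// ltr_nat.
  have dh : T - n%:R * h = h by rewrite -{1}hT -mulrBl -natrB// subSnn mul1r.
  have := drift_increment_le T B alpha _ _ adm n0 nT (lexx _).
  rewrite dh => incr.
  rewrite ge0_integralZl//.
  by rewrite [(h ^+ 2 * _ / _)%R]mulrC [leRHS]EFinM lee_wpmul2l.
have fin : (\int[P]_w (\1_A (Y w) : R)%:E \is a fin_num)%E.
  apply: integrable_fin_num => //.
  apply: (bounded_integrable _ _ _ 1 _ mind) => w.
  by rewrite indicE ger0_norm// lern1 leq_b1.
move: tail; rewrite -(fineK fin) => tail ent.
have {}ent := le_trans ent (leeD (le_refl _) cost).
move: tail ent; set q := fine _; rewrite -EFinM -!EFinD !lee_fin => tail ent.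
have lnle : ln (\int[P]_w tilt lam A (B T w))
    <= ln (1 + expR lam * fine (P (B T @^-1` A))).
  have /andP[I1 I2] := integral_tilt_bounds lam A (B T) (ltW lam0) mA.
  by rewrite ler_ln// ?posrE (lt_le_trans ltr01)// (le_trans I1).
have := ler_wpM2l (ltW lam0) tail; rewrite mulr1 mulrDr => h1.
apply: le_trans h1 _; rewrite lerD2r; apply: le_trans ent _.
by rewrite lerD2r.
Qed.

Lemma entropy_ball T B alpha (V eps lam : R) : 0 < T ->
  standard_brownian_motion T B -> admissible T B alpha ->
  (\forall w \ae P, `|terminal_value T B alpha w| <= V) ->
  0 < eps -> 0 < lam ->
  lam <= ln (1 + expR lam * fine (P (B T @^-1` `[- (V + eps), V + eps]))) + T / pi.
Proof.
move=> T0 hB adm XV eps0 lam0; apply/ler_addgt0Pr => e e0.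
pose K := lam * (T ^+ 2 * (2 / pi) / eps ^+ 2).
have K0 : 0 <= K.
  by rewrite mulr_ge0 ?(ltW lam0)// divr_ge0 ?sqr_ge0// mulr_ge0 ?sqr_ge0// divr_ge0// pi_ge0.
(* The Chebyshev term equals [K / n.+1%:R ^+ 2], which is at most [K / n.+1%:R], hence below [e]. *)
pose n := Num.bound (K / e).
have nK : K / e < n.+1%:R.
  by rewrite (lt_trans (archi_boundP _)) ?ltr_nat ?ltnSn// divr_ge0 ?(ltW e0).
apply: le_trans (entropy_ball_step T B alpha V eps lam n T0 hB adm XV eps0 lam0) _.
rewrite lerD2l (_ : _ * _ = K / n.+1%:R ^+ 2); last first.
  have m0 : n.+1%:R != 0 :> R by rewrite pnatr_eq0.
  rewrite /K; move: (n.+1%:R : R) m0 (pi : R)^-1 => m m0 q.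
  by field; rewrite m0 gt_eqF.
rewrite ler_pdivrMr ?exprn_gt0//.
move: nK; rewrite ltr_pdivrMr// => /ltW/le_trans; apply.
by rewrite mulrC ler_pM2l// ler_eXnr// ler1n.
Qed.

Lemma ball_probability_ge T B alpha (V eps : R) : 0 < T ->
  standard_brownian_motion T B -> admissible T B alpha ->
  (\forall w \ae P, `|terminal_value T B alpha w| <= V) -> 0 < eps ->
  expR (- (T / pi)) <= fine (P (B T @^-1` `[- (V + eps), V + eps])).
Proof.
move=> T0 hB adm XV eps0; apply/ler_addgt0Pr => e e0.
(* Exponentiating and dividing by [expR lam] leaves the error [expR (- lam)]; for [lam = e^-1] it is
   at most [lam^-1 = e]. *)
have lam0 : 0 < e^-1 by rewrite invr_gt0.
have := entropy_ball T B alpha V eps _ T0 hB adm XV eps0 lam0.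
set p := fine _; set lam := e^-1; move=> h.
have p0 : 0 <= p by rewrite fine_ge0.
have pos : 0 < 1 + expR lam * p by rewrite ltr_pwDl// mulr_ge0 ?expR_ge0.
have : expR (lam - T / pi) <= 1 + expR lam * p.
  by rewrite -[leRHS](lnK (pos : _ \is Num.pos)) ler_expR lerBlDr.
rewrite expRD -(ler_pM2l (expR_gt0 (- lam))) mulrA -expRD addNr expR0 mul1r.
rewrite mulrDr mulr1 mulrA -expRD addNr expR0 mul1r addrC => /le_trans; apply.
rewrite lerD2l expRN -[leRHS]invrK lef_pV2 ?posrE ?expR_gt0//.
by apply: le_trans (expR_ge1Dx lam); rewrite lerDr.
Qed.

(** The ball of radius [V + eps] has Gaussian mass [2 * Phi ((V + eps) / Num.sqrt T) - 1], at least
    [expR (- (T / pi))]. Strict monotonicity of [Phi] inverts this, and [eps] is arbitrary. *)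
Lemma terminal_value_bound T B alpha (V : R) : 0 < T -> 0 <= V ->
  standard_brownian_motion T B -> admissible T B alpha ->
  (\forall w \ae P, `|terminal_value T B alpha w| <= V) ->
  Num.sqrt T * Phi_inv ((1 + expR (- (T / pi))) / 2) <= V.
Proof.
move=> T0 V0 hB adm XV; apply/ler_addgt0Pr => eps eps0.
have sT : 0 < Num.sqrt T by rewrite sqrtr_gt0.
set v := (1 + expR (- (T / pi))) / 2.
have e1 : expR (- (T / pi)) < 1.
  by rewrite -[ltRHS]expR0 ltr_expR oppr_lt0 divr_gt0// pi_gt0.
have e0 := expR_gt0 (- (T / pi) : R).
have vrange : 1 / 2 < v < 1 by apply/andP; split; rewrite /v; lra.
have Phiv : Phi (Phi_inv v) = v.
  by rewrite /Phi_inv pinvK// inE; exact: Phi_surj.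
have r0 : 0 <= V + eps by rewrite addr_ge0// ltW.
have := ball_probability_ge T B alpha V eps T0 hB adm XV eps0.
rewrite brownian_symmetric_itv//= => ball.
rewrite mulrC -ler_pdivlMr// leNgt; apply/negP => /Phi_lt.
by rewrite Phiv ltNge => /negP; apply; rewrite /v; lra.
Qed.

End controlled_brownian_motion.

Theorem proposition6p5 (R : realType) (d : measure_display)
  (Omega : measurableType d) (P : probability Omega R)
  (T : R) (hT : 0 < T) (B : R -> {RV P >-> R})
  (hB : standard_brownian_motion T B) :
  ((Num.sqrt T * Phi_inv ((1 + expR (- (T / pi))) / 2))%:E <= V_infty T B)%E.
Proof.
apply: le_ereal_inf_tmp => _ [alpha adm <-].
have N0 : (0 <= 'N[P]_+oo [EFin \o terminal_value T B alpha])%E := Lnorm_ge0 _ _ _.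
have ess : \forall w \ae P, (`|(terminal_value T B alpha w)%:E| <=
    'N[P]_+oo [EFin \o terminal_value T B alpha])%E.
  (* The sup norm unfolds to the essential supremum when the total mass is positive. *)
  have P0 : (0 < P setT)%E by rewrite probability_setT.
  rewrite (_ : 'N[P]_+oo [_] = ess_sup P (abse \o (EFin \o terminal_value T B alpha)))%E.
    exact: ess_sup_ge.
  by rewrite unlock P0.
(* An infinite norm makes the bound trivial, and nonnegativity excludes [-oo]; only a real [V]
   remains. *)
move: N0 ess; case: ('N[P]_+oo [_])%E => [V| |]// V0 ess; last by rewrite leey.
have XV : \forall w \ae P, `|terminal_value T B alpha w| <= V.
  by apply: filterS ess => w; rewrite lee_fin.
by rewrite lee_fin (terminal_value_bound P T B alpha V hT _ hB adm XV).
Qed.
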